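(* Let $K$ be a compact subset of $\mathbb{R}^n$, let $M>0$, and let $N:K\to\mathbb{R}^n$ be an $M$-Lipschitz mapping such that $|N(y)|=1$ for every $y\in K$. Then the following statements are equivalent: (1) There exists a $C^{1,1}$ convex body $V$ with $0\in\mathrm{int}(V)$ such that $K\subseteq\partial V$ and $N(y)$ is outwardly normal to $\partial V$ at $y$ for every $y\in K$. (2) $\langle N(y),y\rangle>0$ for all $y\in K$, and there exists $\eta\in(0,\tfrac12]$ such that $$\langle N(y),y-x\rangle\geq\frac{\eta}{2M}|N(y)-N(x)|^2\quad\text{for all }x,y\in K.$$
   Context: A convex body is a compact convex subset of $\mathbb{R}^n$ with nonempty interior; it is a $C^{1,1}$ convex body if its boundary is a hypersurface of class $C^{1,1}$ (i.e. $C^1$ with locally Lipschitz unit normal). *)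

(* Defs.v *)
From mathcomp Require Import all_boot all_order all_algebra.
From mathcomp Require Import all_classical all_reals all_analysis.
Import Order.TTheory GRing.Theory Num.Theory.
Import numFieldNormedType.Exports.

Set Implicit Arguments.
Unset Strict Implicit.
Unset Printing Implicit Defensive.

Local Open Scope classical_set_scope.
Local Open Scope ring_scope.

(* The library norm on 'rV[R]_n is the sup norm: it induces the usual topology *)
(* and differential calculus, but the Euclidean metric has to be defined.      *)
Definition edot (R : realType) (n : nat) (u v : 'rV[R]_n) : R :=
  \sum_(i < n) u 0 i * v 0 i.

Definition enorm (R : realType) (n : nat) (u : 'rV[R]_n) : R :=
  Num.sqrt (edot u u).

Definition elipschitz_on (R : realType) (n : nat) (A : set 'rV[R]_n) (k : R)
    (F : 'rV[R]_n -> 'rV[R]_n) : Prop :=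
  forall x y, A x -> A y -> enorm (F x - F y) <= k * enorm (x - y).

Definition frontier (T : topologicalType) (A : set T) : set T :=
  closure A `\` A°.

Definition grad (R : realType) (n : nat) (f : 'rV[R]_n -> R) (x : 'rV[R]_n) :
    'rV[R]_n :=
  \row_(i < n) 'D_(delta_mx 0 i) f x.

Definition C1_on (R : realType) (n : nat) (U : set 'rV[R]_n)
    (f : 'rV[R]_n -> R) : Prop :=
  forall x, U x -> differentiable f x /\ {for x, continuous (grad f)}.

(* f is a C^1 equation, with nowhere vanishing gradient, of the part of S lying *)
(* in the open set U.                                                           *)
Definition C1_equation (R : realType) (n : nat) (S U : set 'rV[R]_n)
    (f : 'rV[R]_n -> R) : Prop :=
  [/\ open U, C1_on U f, forall x, U x -> grad f x != 0 &
      S `&` U = [set x | f x = 0] `&` U].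

Definition grad_normal (R : realType) (n : nat) (f : 'rV[R]_n -> R)
    (x : 'rV[R]_n) : 'rV[R]_n :=
  (enorm (grad f x))^-1 *: grad f x.

Definition C11_hypersurface (R : realType) (n : nat) (S : set 'rV[R]_n) : Prop :=
  forall p, S p -> exists (U : set 'rV[R]_n) (f : 'rV[R]_n -> R),
    [/\ U p, C1_equation S U f &
        exists L : R, elipschitz_on (S `&` U) L (grad_normal f)].

Definition convex_body (R : realType) (n : nat) (V : set 'rV[R]_n) : Prop :=
  [/\ compact V, convex_set V & V° !=set0].

Definition C11_convex_body (R : realType) (n : nat) (V : set 'rV[R]_n) : Prop :=
  convex_body V /\ C11_hypersurface (frontier V).

(* The curve g is only required to be differentiable at 0; on a C^1 hypersurface *)
(* this yields the same tangent space as C^1 curves.                            *)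
Definition tangent_vector (R : realType) (n : nat) (S : set 'rV[R]_n)
    (p v : 'rV[R]_n) : Prop :=
  exists g : R -> 'rV[R]_n,
    [/\ g 0 = p, \forall t \near (0 : R), S (g t) & is_derive (0 : R) 1 g v].

Definition normal_vector (R : realType) (n : nat) (S : set 'rV[R]_n)
    (p u : 'rV[R]_n) : Prop :=
  forall v, tangent_vector S p v -> edot u v = 0.

Definition outwardly_normal (R : realType) (n : nat) (V : set 'rV[R]_n)
    (p u : 'rV[R]_n) : Prop :=
  normal_vector (frontier V) p u /\ \forall t \near (0 : R)^'+, ~ V (p + t *: u).

(* Main.v *)
(* (2) => (1).  For small r > 0, (2) says exactly that every point x - r N(x)
   lies in all the half-spaces <N(y), w> <= <N(y), y> - r.  Let W be the
   intersection of these half-spaces, cut off by a large ball, and V = W + B(0, r).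
   V is supported at y by N(y), and its boundary is the level set d(., W)^2 = r^2,
   where d(., W)^2 is C^1 with gradient 2 (x - P x), P being the projection onto W,
   and x - P x is 1-Lipschitz in x.

   (1) => (2).  A convex body with C^{1,1} boundary has, locally uniformly, an inner
   rolling ball: x - r N(x) + B(0, r) is contained in V.  Testing the supporting
   half-space at y against this ball gives
   <N(y), y - x> >= r (1 - <N(x), N(y)>) = (r / 2) |N(y) - N(x)|^2. *)
From HB Require Import structures.
Require Import Defs.
From mathcomp Require Import all_boot all_order all_algebra.
From mathcomp Require Import all_classical all_reals all_analysis.
From mathcomp Require Import ring lra.
Import Order.TTheory GRing.Theory Num.Theory.
Import numFieldNormedType.Exports.

Local Open Scope classical_set_scope.
Local Open Scope ring_scope.

(** * Euclidean structure *)

Section Euclidean.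
Local Set Implicit Arguments.
Local Unset Strict Implicit.
Context {R : realType} {n : nat}.
Implicit Types (u v w : 'rV[R]_n) (k : R).

Lemma edotC u v : edot u v = edot v u.
Proof. by apply: eq_bigr => i _; rewrite mulrC. Qed.

Lemma edotDl u v w : edot (u + v) w = edot u w + edot v w.
Proof. by rewrite -big_split; apply: eq_bigr => i _; rewrite mxE mulrDl. Qed.

Lemma edotZl k u v : edot (k *: u) v = k * edot u v.
Proof. by rewrite /edot mulr_sumr; apply: eq_bigr => i _; rewrite mxE mulrA. Qed.

Lemma edotNl u v : edot (- u) v = - edot u v.
Proof. by rewrite -scaleN1r edotZl mulN1r. Qed.

Lemma edotDr u v w : edot u (v + w) = edot u v + edot u w.
Proof. by rewrite edotC edotDl !(edotC u). Qed.

Lemma edotZr k u v : edot u (k *: v) = k * edot u v.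
Proof. by rewrite edotC edotZl edotC. Qed.

Lemma edotNr u v : edot u (- v) = - edot u v.
Proof. by rewrite edotC edotNl edotC. Qed.

Lemma edot0l u : edot 0 u = 0.
Proof. by rewrite -(scale0r u) edotZl mul0r. Qed.

Lemma edot0r u : edot u 0 = 0.
Proof. by rewrite edotC edot0l. Qed.

Definition edotE := (edotDl, edotDr, edotNl, edotNr, edotZl, edotZr, edot0l, edot0r).

Lemma edot_ge0 u : 0 <= edot u u.
Proof. by apply: sumr_ge0 => i _; rewrite -expr2 sqr_ge0. Qed.

Lemma enorm_ge0 u : 0 <= enorm u.
Proof. exact: sqrtr_ge0. Qed.

Lemma sqr_enorm u : enorm u ^+ 2 = edot u u.
Proof. by rewrite sqr_sqrtr // edot_ge0. Qed.

Lemma enorm0 : enorm (0 : 'rV[R]_n) = 0.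
Proof. by rewrite /enorm edot0l sqrtr0. Qed.

Lemma enormZ k u : enorm (k *: u) = `|k| * enorm u.
Proof. by rewrite /enorm !edotE mulrA -expr2 sqrtrM ?sqr_ge0 // sqrtr_sqr. Qed.

Lemma enormN u : enorm (- u) = enorm u.
Proof. by rewrite -scaleN1r enormZ normrN1 mul1r. Qed.

Lemma coord_le_enorm u i : `|u 0 i| <= enorm u.
Proof.
rewrite -sqrtr_sqr ler_sqrt ?edot_ge0 // /edot (bigD1 i) //= -expr2 lerDl.
by apply: sumr_ge0 => j _; rewrite -expr2 sqr_ge0.
Qed.

Lemma normr_le_enorm u : `|u| <= enorm u.
Proof.
rewrite [leLHS]/Num.norm/= mx_normrE; apply/bigmax_leP; split; first exact: enorm_ge0.
by move=> [i j] _ /=; rewrite (ord1 i) coord_le_enorm.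
Qed.

Lemma coord_le_normr u i : `|u 0 i| <= `|u|.
Proof.
rewrite [leRHS]/Num.norm/= mx_normrE.
exact: (le_bigmax _ (fun ij : 'I_1 * 'I_n => `|u ij.1 ij.2|) (0, i)).
Qed.

Lemma enorm_le_normr u : enorm u <= Num.sqrt n%:R * `|u|.
Proof.
rewrite -[`|u|]normr_id -sqrtr_sqr -sqrtrM ?ler0n // ler_sqrt; last first.
  by rewrite mulr_ge0 ?ler0n ?sqr_ge0.
rewrite -[X in X%:R * _](card_ord n) mulr_natl -sumr_const.
apply: ler_sum => i _; rewrite -expr2 -[u 0 i ^+ 2]real_normK ?num_real //.
by rewrite ler_pXn2r ?nnegrE ?normr_ge0 ?coord_le_normr.
Qed.

Lemma enorm_eq0 u : enorm u = 0 -> u = 0.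
Proof.
move=> u0; apply/eqP; rewrite -normr_le0.
by rewrite -u0 normr_le_enorm.
Qed.

Lemma enorm_gt0 u : u != 0 -> 0 < enorm u.
Proof.
by move=> u0; rewrite lt_neqAle enorm_ge0 andbT eq_sym; apply: contra_neq u0 => /enorm_eq0.
Qed.

(** Cauchy-Schwarz: with [a], [b] the norms of [u], [v] and [c] their product, [|b u - a v|^2 >= 0]
    expands to [2ab(ab - c) >= 0], and [ab > 0] can be divided out. *)
Lemma edot_le_enorm u v : edot u v <= enorm u * enorm v.
Proof.
have [v0|v0] := eqVneq v 0; first by rewrite v0 edot0r enorm0 mulr0.
have [u0|u0] := eqVneq u 0; first by rewrite u0 edot0l enorm0 mul0r.
have := edot_ge0 (enorm v *: u - enorm u *: v).
rewrite !edotE (edotC v u) -!sqr_enorm.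
move: (enorm_gt0 u0) (enorm_gt0 v0).
set a := enorm u; set b := enorm v; set c := edot u v => a0 b0 H.
rewrite -(ler_pM2l (mulr_gt0 a0 b0)); lra.
Qed.

Lemma ler_enormD u v : enorm (u + v) <= enorm u + enorm v.
Proof.
rewrite -(ler_pXn2r (n:=2)) ?nnegrE ?addr_ge0 ?enorm_ge0 //.
rewrite sqr_enorm !edotE (edotC v u) -!sqr_enorm.
have := edot_le_enorm u v; lra.
Qed.

Lemma le_enorm u v : (enorm u <= enorm v) = (edot u u <= edot v v).
Proof. by rewrite ler_sqrt ?edot_ge0. Qed.

Lemma cvg_edot (T : Type) (F : set_system T) {FF : Filter F} (f g : T -> 'rV[R]_n) u v :
  f @ F --> u -> g @ F --> v -> edot (f x) (g x) @[x --> F] --> edot u v.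
Proof.
move=> fu gv; apply: cvg_big => [|i _]; first exact: add_continuous.
apply: cvgM.
  exact: (cvg_comp _ (fun w : 'rV[R]_n => w 0 i) fu (@coord_continuous _ _ _ 0 i u)).
exact: (cvg_comp _ (fun w : 'rV[R]_n => w 0 i) gv (@coord_continuous _ _ _ 0 i v)).
Qed.

Lemma cvg_enorm (T : Type) (F : set_system T) {FF : Filter F} (f : T -> 'rV[R]_n) u :
  f @ F --> u -> enorm (f x) @[x --> F] --> enorm u.
Proof.
move=> fu; exact: (cvg_comp (fun x => edot (f x) (f x)) _ (cvg_edot fu fu) (@sqrt_continuous R _)).
Qed.

(** The ambient topology is that of the sup norm; this allows all later neighbourhood arguments to
    be run with Euclidean balls. *)
Lemma nbhs_enormP u (A : set 'rV[R]_n) :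
  nbhs u A <-> exists2 e, 0 < e & forall v, enorm (v - u) < e -> A v.
Proof.
split=> [/nbhs_ballP[e /= e0 eA]|[e e0 eA]].
  exists e => // v ve; apply: eA; rewrite -ball_normE /= distrC.
  exact: le_lt_trans (normr_le_enorm _) ve.
have : enorm (v - u) @[v --> u] --> 0.
  rewrite -[X in _ --> X]enorm0 -(subrr u).
  exact: cvg_enorm (cvgB cvg_id (cvg_cst u)).
move=> /cvgr_lt/(_ _ e0) H; near=> v; apply: eA; near: v; exact: H.
Unshelve. all: by end_near. Qed.

End Euclidean.

(** * Gradients *)

Section Convexity.
Context {R : realType} {n : nat}.
Local Set Implicit Arguments.
Local Unset Strict Implicit.
Implicit Types (u v w : 'rV[R]_n) (k : R).

Lemma convex_setP (V : set 'rV[R]_n) :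
  convex_set V <->
  forall x y t, V x -> V y -> 0 <= t <= 1 -> V (t *: x + (1 - t) *: y).
Proof.
split=> [cV x y t Vx Vy /andP[t0 t1]|cV x y l].
  have := cV x y (Itv01 t0 t1); rewrite !inE => /(_ Vx Vy).
  by rewrite /conv.
by rewrite !inE => Vx Vy; apply: cV => //; rewrite ge0 le1.
Qed.

End Convexity.

Lemma edot_is_linear {R : realType} {n : nat} (a : 'rV[R]_n) :
  linear (edot a : 'rV[R]_n -> R^o).
Proof. by move=> k u v; rewrite !edotE. Qed.

HB.instance Definition _ {R : realType} {n : nat} (a : 'rV[R]_n) :=
  GRing.isLinear.Build R 'rV[R]_n R^o *:%R (edot a) (edot_is_linear a).

Section Gradient.
Context {R : realType} {n : nat}.
Local Set Implicit Arguments.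
Local Unset Strict Implicit.
Implicit Types (a u v w x : 'rV[R]_n) (k : R).

Lemma continuous_edot a : continuous (edot a).
Proof.
move=> u.
exact: (@cvg_edot _ _ _ (nbhs (u : 'rV[R]_n)) _ (cst a) id a u (cvg_cst a) cvg_id).
Qed.

Lemma differentiable_grad (f : 'rV[R]_n -> R) x v :
  differentiable f x -> 'd f x v = edot (grad f x) v.
Proof.
move=> df; rewrite {1}(row_sum_delta v) linear_sum /edot; apply: eq_bigr => i _.
by rewrite linearZ /grad mxE deriveE // mulrC.
Qed.

Lemma differentiable_edotP (f : 'rV[R]_n -> R) x : differentiable f x ->
  forall e, 0 < e -> exists2 d, 0 < d & forall h, enorm h < d ->
    `|f (x + h) - f x - edot (grad f x) h| <= e * enorm h.
Proof.
move=> df e e0; have /diff_locally/eqaddoP/(_ _ e0) := df.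
move=> /nbhs_enormP[d d0 Hd]; exists d => // h hd.
have := Hd h; rewrite subr0 => /(_ hd) /=.
rewrite /cst /= !fctE /= (addrC h) opprD addrA differentiable_grad // => /le_trans; apply.
by rewrite ler_wpM2l ?(ltW e0) // normr_le_enorm.
Qed.

(** A quadratic remainder is [o(h)], so uniqueness of the differential identifies it with [edot a];
    evaluating on the standard basis recovers [a]. *)
Lemma grad_of_expansion (f : 'rV[R]_n -> R) x a :
  (forall h, `|f (x + h) - f x - edot a h| <= enorm h ^+ 2) ->
  differentiable f x /\ grad f x = a.
Proof.
move=> H.
have ca : continuous (edot a) by exact: continuous_edot.
pose a' : {linear 'rV[R]_n -> R^o} := edot a.
pose f' : 'rV[R]_n -> R^o := f.
have fa : f' \o shift x = cst (f' x) + a' +o_ (0 : 'rV[R]_n) id.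
  apply/eqaddoP => e e0; apply/nbhs_enormP.
  have c0 : 0 <= Num.sqrt n%:R :> R by exact: sqrtr_ge0.
  (* The little-o is stated in the sup norm, which costs the factor [sqrt n]; the added 1 keeps the
     denominator positive when [n = 0]. *)
  exists (e / (Num.sqrt n%:R + 1)); first by rewrite divr_gt0 // ltr_wpDl.
  move=> h; rewrite subr0 ltr_pdivlMr ?ltr_wpDl // => hd.
  rewrite /cst /= !fctE /= (addrC h) opprD addrA.
  apply: le_trans (H h) _; rewrite expr2.
  apply: le_trans (ler_wpM2l (enorm_ge0 h) (enorm_le_normr h)) _.
  rewrite mulrA ler_wpM2r //; have := enorm_ge0 h; lra.
have da : 'd f' x = a' :> (_ -> _) by exact: diff_unique ca fa.
have df : differentiable f x.
  by apply/diff_locallyP; rewrite da.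
split=> //; apply/rowP => i; rewrite mxE deriveE // da /a' /= /edot (bigD1 i) //=.
rewrite big1 => [|j ji]; first by rewrite mxE !eqxx mulr1 addr0.
by rewrite mxE eqxx (negbTE ji) mulr0.
Qed.

End Gradient.

(** * Projection onto a convex set and parallel bodies *)

Section Projection.
Context {R : realType} {n : nat}.
Local Set Implicit Arguments.
Local Unset Strict Implicit.
Variable W : set 'rV[R]_n.

(** [P x] minimizes the squared distance to [x] over [W]; the obtuse-angle inequality is the
    first-order condition at the minimum. *)
Lemma projection_exists :
  compact W -> convex_set W -> W !=set0 ->
  exists P : 'rV[R]_n -> 'rV[R]_n,
    forall x, W (P x) /\ forall w, W w -> edot (x - P x) (w - P x) <= 0.
Proof.
move=> cW /convex_setP vW W0.
suff /choice[P PP] : forall x : 'rV[R]_n, exists p, W p /\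
    forall w, W w -> edot (x - p) (w - p) <= 0 by exists P.
move=> x.
have cf : {within W, continuous (fun w => edot (x - w) (x - w))}.
  apply: continuous_subspaceT; move=> /= w.
  have xw : (fun z : 'rV[R]_n => x - z) @ nbhs (w : 'rV[R]_n) --> (x - w : 'rV[R]_n).
    by apply: cvgB; [exact: (cvg_cst x)|exact: cvg_id].
  exact: (cvg_edot xw xw).
have [p /set_mem Wp pmin] := EVT_min_rV W0 cW cf.
exists p; split=> // w Ww; rewrite leNgt; apply/negP => c0.
set c := edot _ _ in c0; set D := edot (w - p) (w - p).
have D0 : 0 <= D by exact: edot_ge0.
(* Moving from [p] towards [w] by the fraction [t] changes the squared distance by [t^2 D - 2tc].
   This [t] lies in [0, 1], and [t (c + D) = c] makes the change equal to [- t (c + t c) < 0]. *)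
pose t := c / (c + D).
have cD0 : 0 < c + D by rewrite ltr_wpDr.
have t01 : 0 <= t <= 1.
  by rewrite divr_ge0 ?(ltW c0) ?(ltW cD0) //= ler_pdivrMr // mul1r lerDl.
have := pmin (t *: w + (1 - t) *: p) (mem_set (vW _ _ _ Ww Wp t01)).
have -> : x - (t *: w + (1 - t) *: p) = (x - p) - t *: (w - p).
  by apply/rowP => i; rewrite !mxE; ring.
move: (x - p) (w - p) @c @D @t c0 D0 cD0 t01 => q v c D t c0 D0 cD0 t01.
rewrite !edotE (edotC v q) -/c -/D => H.
have tD : t * (c + D) = c by rewrite /t divfK // gt_eqF.
have t0 : 0 < t by rewrite divr_gt0.
have : 0 < t * (c + t * c) by rewrite mulr_gt0 // addr_gt0 // mulr_gt0.
have : t * (c + D) * t = c * t by rewrite tD.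
lra.
Qed.

Variable P : 'rV[R]_n -> 'rV[R]_n.
Hypothesis PP : forall x, W (P x) /\ forall w, W w -> edot (x - P x) (w - P x) <= 0.

Let d2 (x : 'rV[R]_n) := edot (x - P x) (x - P x).

(** Sum of the obtuse-angle inequalities at [x] and at [y], each tested against the projection of
    the other point. *)
Lemma residual_monotone x y : 0 <= edot ((x - P x) - (y - P y)) (P x - P y).
Proof.
have [Wx /(_ _ (PP y).1)] := PP x; have [Wy /(_ _ Wx)] := PP y.
rewrite !edotE; lra.
Qed.

Lemma residual_lipschitz x y : enorm ((x - P x) - (y - P y)) <= enorm (x - y).
Proof.
rewrite le_enorm; have := residual_monotone x y.
have -> : x - y = ((x - P x) - (y - P y)) + (P x - P y).
  by apply/rowP => i; rewrite !mxE; ring.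
move: (_ - (y - P y)) (P x - P y) => q u; have := edot_ge0 u.
rewrite !edotE (edotC u q); lra.
Qed.

Lemma sqdist_le x w : W w -> d2 x <= edot (x - w) (x - w).
Proof.
move=> Ww; have [_ /(_ _ Ww)] := PP x.
have -> : x - w = (x - P x) - (w - P x) by apply/rowP => i; rewrite !mxE; ring.
rewrite /d2; move: (x - P x) (w - P x) => q u; have := edot_ge0 u.
rewrite !edotE (edotC u q); lra.
Qed.

(** Upper bound: [P x] competes for the point [x + h]. Lower bound: the obtuse-angle inequality at
    [x] against [P (x + h)] leaves a complete square [|h - u|^2]. *)
Lemma sqdist_expansion x h :
  0 <= d2 (x + h) - d2 x - 2 * edot (x - P x) h <= edot h h.
Proof.
have := sqdist_le (x + h) (PP x).1; have [_ /(_ _ (PP (x + h)).1)] := PP x.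
rewrite /d2.
have -> : x + h - P x = (x - P x) + h by apply/rowP => i; rewrite !mxE; ring.
have -> : x + h - P (x + h) = (x - P x) + h - (P (x + h) - P x).
  by apply/rowP => i; rewrite !mxE; ring.
move: (x - P x) (P (x + h) - P x) => q u; have := edot_ge0 (h - u).
rewrite !edotE (edotC u q) (edotC u h) (edotC h q); lra.
Qed.

Lemma sqdist_grad x c : differentiable (fun x => d2 x - c) x /\
  grad (fun x => d2 x - c) x = 2 *: (x - P x).
Proof.
apply: grad_of_expansion => h; rewrite edotZl sqr_enorm.
have -> : d2 (x + h) - c - (d2 x - c) = d2 (x + h) - d2 x by ring.
by have /andP[? ?] := sqdist_expansion x h; rewrite ger0_norm.
Qed.

Lemma residual_continuous : continuous (fun x : 'rV[R]_n => x - P x).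
Proof.
move=> x A /nbhs_enormP[e e0 eA]; apply/nbhs_enormP; exists e => // y yx.
by apply: eA; apply: le_lt_trans yx; exact: residual_lipschitz.
Qed.

Lemma sqdist_continuous : continuous d2.
Proof.
by move=> x; exact: (cvg_edot (@residual_continuous x) (@residual_continuous x)).
Qed.

Lemma projection_unique x p :
  W p -> (forall w, W w -> edot (x - p) (w - p) <= 0) -> P x = p.
Proof.
move=> Wp H; have [Wx /(_ _ Wp)] := PP x; have := H _ Wx.
have -> : x - p = (x - P x) + (P x - p) by apply/rowP => i; rewrite !mxE; ring.
have -> : p - P x = - (P x - p) by rewrite opprB.
rewrite !edotE => H1 H2; apply/eqP; rewrite -subr_eq0; apply/eqP/enorm_eq0.
apply/eqP; rewrite -sqrf_eq0 sqr_enorm eq_le edot_ge0 andbT.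
by rewrite !edotE; lra.
Qed.

(** For [r >= 0] this is [W + B(0, r)] with closed balls; the squared distance is used because it is
    C^1 on the whole space. *)
Definition parallel_body r : set 'rV[R]_n := [set x | d2 x <= r ^+ 2].

Lemma parallel_body_closed r : closed (parallel_body r).
Proof.
apply: (@closed_comp _ _ d2 [set z | z <= r ^+ 2]) => [x _|]; last exact: closed_le.
exact: sqdist_continuous.
Qed.

Lemma parallel_body_convex r : 0 <= r -> convex_set W -> convex_set (parallel_body r).
Proof.
move=> r0 /convex_setP vW; apply/convex_setP => x y t Vx Vy /[dup] t01 /andP[t0 t1].
rewrite /parallel_body /=.
have h z : d2 z <= r ^+ 2 -> enorm (z - P z) <= r.
  by rewrite /d2 -sqr_enorm ler_pXn2r ?nnegrE ?enorm_ge0.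
apply: le_trans (sqdist_le _ (vW _ _ _ (PP x).1 (PP y).1 t01)) _.
have -> : t *: x + (1 - t) *: y - (t *: P x + (1 - t) *: P y) =
    t *: (x - P x) + (1 - t) *: (y - P y).
  by apply/rowP => i; rewrite !mxE; ring.
rewrite -sqr_enorm ler_pXn2r ?nnegrE ?enorm_ge0 //.
apply: le_trans (ler_enormD _ _) _; rewrite !enormZ !ger0_norm ?subr_ge0 //.
have := ler_wpM2l t0 (h _ Vx).
have t1' : 0 <= 1 - t by rewrite subr_ge0.
have := ler_wpM2l t1' (h _ Vy); lra.
Qed.

Lemma parallel_body_compact r : 0 <= r -> compact W -> compact (parallel_body r).
Proof.
move=> r0 /compact_bounded[M [Mr HM]].
apply: bounded_closed_compact; last exact: parallel_body_closed.
exists (`|M| + 1 + r); split; first exact: num_real.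
move=> B MB x Vx; apply: le_trans (ltW MB).
rewrite -(subrK (P x) x); apply: le_trans (ler_normD _ _) _.
rewrite addrC lerD //.
  apply: HM (PP x).1; apply: le_lt_trans (ler_norm _) _; rewrite ltrDl //.
apply: le_trans (normr_le_enorm _) _.
by move: Vx; rewrite /parallel_body /= /d2 -sqr_enorm ler_pXn2r ?nnegrE ?enorm_ge0.
Qed.

Lemma parallel_body_interior r : 0 < r -> (parallel_body r)° = [set x | d2 x < r ^+ 2].
Proof.
move=> r0; apply/seteqP; split=> x; last first.
  move=> xr; have /cvgr_lt/(_ _ xr) := @sqdist_continuous x.
  by apply: filterS => y; exact: ltW.
move=> ix; have /interior_subset := ix; rewrite /parallel_body /= le_eqVlt.
move=> /orP[/eqP dx|//].
have [q0|q0] := eqVneq (x - P x) 0.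
  by move: dx; rewrite /d2 q0 edot0l => /eqP; rewrite eq_sym sqrf_eq0 gt_eqF.
have /nbhs_enormP[e e0 He] := ix.
(* Pushing [x] outward along [x - P x] leaves its projection unchanged and multiplies [d2] by
   [(1 + t)^2], so a point with [d2 x = r^2] has points outside the body arbitrarily near. *)
pose t := e / 2 / enorm (x - P x).
have qg := enorm_gt0 q0.
have t0 : 0 < t by rewrite !divr_gt0.
have te : t * enorm (x - P x) = e / 2 by rewrite /t divfK ?gt_eqF.
clearbody t.
have := He (x + t *: (x - P x)).
rewrite addrAC subrr add0r enormZ gtr0_norm // te => /(_ ltac:(lra)).
rewrite /parallel_body /= -dx /d2.
have -> : P (x + t *: (x - P x)) = P x.
  apply: projection_unique; first exact: (PP x).1.
  move=> w Ww.
  have -> : x + t *: (x - P x) - P x = (1 + t) *: (x - P x).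
    by apply/rowP => i; rewrite !mxE; ring.
  by rewrite edotZl pmulr_rle0 ?addr_gt0 //; exact: (PP x).2.
have -> : x + t *: (x - P x) - P x = (1 + t) *: (x - P x).
  by apply/rowP => i; rewrite !mxE; ring.
rewrite edotZl edotZr -sqr_enorm => H.
have q2 : 0 < enorm (x - P x) ^+ 2 by rewrite exprn_gt0.
have := mulr_gt0 t0 q2; have := mulr_gt0 t0 (mulr_gt0 t0 q2).
lra.
Qed.

End Projection.

(** * Supporting half-spaces, uniform radii on compact sets, and C^{1,1} regularity of parallel
    bodies *)

Section Bodies.
Context {R : realType} {n : nat}.
Local Set Implicit Arguments.
Local Unset Strict Implicit.

Lemma near_right0P (Q : R -> Prop) :
  (\forall t \near (0 : R)^'+, Q t) <->
  exists2 e, 0 < e & forall t, 0 < t -> t < e -> Q t.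
Proof.
split=> [[e /= e0 eQ]|[e e0 eQ]].
  by exists e => // t t0 te; apply: (eQ t _ t0); rewrite /= distrC subr0 gtr0_norm.
exists e => // t /=; rewrite distrC subr0 => te t0; apply: eQ => //.
by rewrite -(gtr0_norm t0).
Qed.

(** Turns radii valid near each point of [K] into one radius valid on [K]; it serves both for the
    lower bound of the support values and for the rolling radius. *)
Lemma compact_near_right0 (K : set 'rV[R]_n) (Q : R -> 'rV[R]_n -> Prop) :
  compact K ->
  (forall x, K x -> exists2 e, 0 < e & forall y r,
     K y -> enorm (y - x) < e -> 0 < r < e -> Q r y) ->
  exists2 e, 0 < e & forall r, 0 < r < e -> forall y, K y -> Q r y.
Proof.
move=> /compact_near_coveringP/near_covering_withinP cK H.
have : \forall r \near (0 : R)^'+, K `<=` Q r.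
  apply: cK => x Kx; have [e e0 He] := H x Kx.
  exists ([set y | enorm (y - x) < e], [set r | 0 < r < e]) => /=.
    split; first by apply/nbhs_enormP; exists e.
    by apply/near_right0P; exists e => // t t0 te; rewrite /= t0.
  by move=> [y r] /= [ye re] Ky; exact: He.
move=> /near_right0P[e e0 He]; exists e => // r /andP[r0 re]; exact: He.
Qed.

(** Along a curve in the frontier through [y], the functional [edot u] is maximal at [y]: its
    difference quotients are nonpositive on the right and nonnegative on the left, so its derivative
    vanishes. Moving along [u] increases the functional, hence leaves [V]. *)
Lemma support_outwardly_normal (V : set 'rV[R]_n) y u :
  closed V -> 0 < edot u u -> (forall x, V x -> edot u x <= edot u y) ->
  outwardly_normal V y u.
Proof.
move=> clV u0 sup; split; last first.
  apply/near_right0P; exists 1 => // t t0 _ /sup.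
  by rewrite !edotE gerDl leNgt mulr_gt0.
move=> v [g [gy Vg [dg gv]]].
have qv : edot u (h^-1 *: (g (h + 0) - y)) @[h --> (0 : R)^'] --> edot u v.
  apply: cvg_edot; first exact: (cvg_cst u).
  rewrite -gv -gy /derive; move: dg; rewrite /derivable.
  by under eq_fun do rewrite /= [_%:A]mulr1.
have Vn : \forall t \near (0 : R), edot u (g (t + 0) - y) <= 0.
  near=> t; rewrite !edotE subr_le0 addr0; apply: sup.
  have : frontier V (g t) by near: t.
  by rewrite /frontier -(closure_id V).1 // => -[].
apply/eqP; rewrite eq_le; apply/andP; split.
  apply: (cvgr_to_le (cvg_dnbhs_at_right qv)); near=> h.
  rewrite edotZr; apply: mulr_ge0_le0.
    by rewrite invr_ge0 ltW //; near: h; exact: nbhs_right_gt.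
  by near: h; exact: cvg_at_right_filter Vn.
apply: (cvgr_to_ge (cvg_dnbhs_at_left qv)); near=> h.
rewrite edotZr; apply: mulr_le0.
  by rewrite invr_le0 ltW //; near: h; exact: nbhs_left_lt.
by near: h; exact: cvg_at_left_filter Vn.
Unshelve. all: by end_near. Qed.

Lemma support_not_interior (V : set 'rV[R]_n) y u :
  0 < edot u u -> (forall x, V x -> edot u x <= edot u y) -> ~ V° y.
Proof.
move=> u0 sup /nbhs_enormP[e e0 He].
have u1 : 0 < enorm u by rewrite sqrtr_gt0.
have := He (y + (e / 2 / enorm u) *: u).
rewrite addrAC subrr add0r enormZ gtr0_norm ?divr_gt0 // divfK ?gt_eqF //.
move=> /(_ ltac:(lra))/sup; rewrite !edotE gerDl leNgt.
by rewrite mulr_gt0 // !divr_gt0.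
Qed.

Lemma frontier_closed (V : set 'rV[R]_n) : closed V -> frontier V = V `\` V°.
Proof. by move=> clV; rewrite /frontier -(closure_id V).1. Qed.

Variables (W : set 'rV[R]_n) (P : 'rV[R]_n -> 'rV[R]_n).
Hypothesis PP : forall x, W (P x) /\ forall w, W w -> edot (x - P x) (w - P x) <= 0.

Lemma frontier_parallel_body r : 0 < r ->
  frontier (parallel_body P r) = [set x | edot (x - P x) (x - P x) = r ^+ 2].
Proof.
move=> r0; rewrite frontier_closed ?(parallel_body_interior PP) //; last first.
  exact: (parallel_body_closed PP).
apply/seteqP; split=> x; rewrite /parallel_body /=.
  by move=> [a /negP]; rewrite -leNgt => b; apply/eqP; rewrite eq_le a b.
by move=> ->; rewrite lexx ltxx.
Qed.

(** The equation [d - r^2] is regular where [d > 0]. On the boundary its unit normal is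
    [(x - P x) / r], whence the Lipschitz constant [1/r]. *)
Lemma parallel_body_C11 r : 0 < r -> compact W -> convex_set W ->
  C11_convex_body (parallel_body P r).
Proof.
move=> r0 cW vW; have rr0 : 0 < r ^+ 2 by rewrite exprn_gt0.
split.
  split; first exact: (parallel_body_compact PP (ltW r0) cW).
    exact: (parallel_body_convex PP (ltW r0) vW).
  exists (P 0); rewrite (parallel_body_interior PP) //=.
  apply: le_lt_trans (sqdist_le PP _ (PP 0).1) _.
  by rewrite subrr edot0l.
rewrite frontier_parallel_body // => p Sp.
pose d x := edot (x - P x) (x - P x).
exists [set x | 0 < d x], (fun x => d x - r ^+ 2); split.
- by rewrite /= /d Sp.
- split.
  + apply: (@open_comp _ _ d [set z | 0 < z]) => [x _|]; last exact: open_gt.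
    exact: (sqdist_continuous PP).
  + move=> x _; split; first exact: (sqdist_grad PP _ _).1.
    have -> : grad (fun x => d x - r ^+ 2) = fun x => 2 *: (x - P x).
      by apply/funext => z; rewrite (sqdist_grad PP _ _).2.
    have := residual_continuous PP (x := x).
    by move=> c; exact: (@cvgZr R 'rV[R]_n 'rV[R]_n (nbhs x) _ 2 _ _ c).
  + move=> x /= dx; rewrite (sqdist_grad PP _ _).2.
    apply: contraTneq dx => /eqP; rewrite scaler_eq0 pnatr_eq0 /= /d => /eqP->.
    by rewrite edot0l ltxx.
  + by apply/seteqP; split=> x /= [+ ?]; split=> //; apply/eqP;
      [rewrite subr_eq0|rewrite -subr_eq0]; apply/eqP.
- exists r^-1 => x y [/= dx _] [/= dy _].
  rewrite /grad_normal !(sqdist_grad PP _ _).2 !enormZ.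
  have e z : edot (z - P z) (z - P z) = r ^+ 2 -> enorm (z - P z) = r.
    by rewrite /enorm => ->; rewrite sqrtr_sqr gtr0_norm.
  rewrite !e // gtr0_norm // invfM !scalerA mulrAC mulVf ?mul1r //.
  rewrite -scalerBr enormZ gtr0_norm ?invr_gt0 // ler_pM2l ?invr_gt0 //.
  exact: (residual_lipschitz PP).
Qed.

End Bodies.

(** * From the inequality to a convex body *)

Section Construction.
Context {R : realType} {n : nat}.
Local Set Implicit Arguments.
Local Unset Strict Implicit.
Variables (K : set 'rV[R]_n) (M : R) (N : 'rV[R]_n -> 'rV[R]_n).
Hypothesis K_compact : compact K.
Hypothesis M_gt0 : 0 < M.
Hypothesis N_lipschitz : elipschitz_on K M N.
Hypothesis N_unit : forall y, K y -> enorm (N y) = 1.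

Lemma N_sqr y : K y -> edot (N y) (N y) = 1.
Proof. by move=> /N_unit N1; rewrite -sqr_enorm N1 expr1n. Qed.

Lemma support_lower_bound : (forall y, K y -> 0 < edot (N y) y) ->
  exists2 e, 0 < e & forall y, K y -> e <= edot (N y) y.
Proof.
move=> pos.
suff [e e0 He] : exists2 e, 0 < e & forall r, 0 < r < e ->
    forall y, K y -> r <= edot (N y) y.
  by exists (e / 2) => [|y]; [rewrite divr_gt0|apply: He; lra].
apply: compact_near_right0 => // x Kx.
set c := edot (N x) x; have c0 : 0 < c by exact: pos.
(* Within distance [e <= 1] of [x], the value of [<N y, y>] drops below [c] by at most [e D]: the
   term in [M] comes from varying [N], the last 1 from varying the point. *)
pose D := M * (enorm x + 1) + 1.
have D0 : 0 < D by rewrite ltr_wpDl // mulr_ge0 ?(ltW M_gt0) // addr_ge0 // enorm_ge0.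
pose e := Num.min 1 (c / 2 / D).
have e1 : e <= 1 by rewrite ge_min lexx.
have eD : e * D <= c / 2 by rewrite -ler_pdivlMr // ge_min lexx orbT.
exists e; first by rewrite lt_min ltr01 !divr_gt0.
move=> y r Ky yx /andP[r0 re].
have dNy : edot (N x - N y) y <= M * e * (enorm x + 1).
  apply: le_trans (edot_le_enorm _ _) _; apply: ler_pM; rewrite ?enorm_ge0 //.
    apply: le_trans (N_lipschitz Kx Ky) _; rewrite ler_pM2l // ltW //.
    by rewrite -enormN opprB.
  rewrite -(subrK x y) addrC; apply: le_trans (ler_enormD _ _) _.
  by rewrite lerD2l (le_trans (ltW yx)).
have dxy : edot (N x) (x - y) <= e.
  apply: le_trans (edot_le_enorm _ _) _; rewrite N_unit // mul1r -enormN opprB.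
  exact: ltW.
have De : r * 1 <= e * D.
  apply: ler_pM; rewrite ?(ltW r0) ?(ltW re) // /D lerDr.
  by rewrite mulr_ge0 ?(ltW M_gt0) // addr_ge0 // enorm_ge0.
move: dNy dxy De eD; rewrite !edotE -/c /D; lra.
Qed.

Lemma body_of_condition eta :
  (forall y, K y -> 0 < edot (N y) y) -> 0 < eta ->
  (forall x y, K x -> K y ->
     eta / (2 * M) * enorm (N y - N x) ^+ 2 <= edot (N y) (y - x)) ->
  exists V : set 'rV[R]_n,
   [/\ C11_convex_body V, V° 0, K `<=` frontier V &
       forall y, K y -> outwardly_normal V y (N y)].
Proof.
move=> pos eta0 cond; have [d d0 Hd] := support_lower_bound pos.
pose c := eta / (2 * M); have c0 : 0 < c by rewrite divr_gt0 // mulr_gt0.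
(* [r <= d] puts 0 in [W]. Since [|N y - N x|^2 = 2 (1 - <N x, N y>)], the bound [r <= 2c] turns the
   hypothesis into [<N y, y - x> >= r (1 - <N x, N y>)], which puts [x - r N x] in [W]. *)
pose r := Num.min d (2 * c).
have rd : r <= d by rewrite ge_min lexx.
have rc : r <= 2 * c by rewrite ge_min lexx orbT.
have r0 : 0 < r by rewrite lt_min d0 mulr_gt0.
have [B [_ HB]] := compact_bounded K_compact.
pose b := `|B| + 1 + r.
(* [b] only serves to make [W] compact. *)
pose W : set 'rV[R]_n := [set w | `|w| <= b] `&`
  \bigcap_(y in K) [set w | edot (N y) w <= edot (N y) y - r].
have W0 : W 0.
  split=> [|y Ky] /=; first by rewrite normr0 !addr_ge0 // ltW.
  by rewrite edot0r subr_ge0 (le_trans rd) // Hd.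
have cW : compact W.
  apply: bounded_closed_compact.
    exists b; split; first exact: num_real.
    by move=> z bz w [wb _]; rewrite /= (le_trans wb) // ltW.
  apply: closedI.
    apply: (@closed_comp _ _ (fun w : 'rV[R]_n => `|w|) [set z | z <= b]) => [w _|];
      last exact: closed_le.
    exact: norm_continuous.
  apply: closed_bigI => y _.
  apply: (@closed_comp _ _ (edot (N y)) [set z | z <= edot (N y) y - r]) => [w _|];
    last exact: closed_le.
  exact: continuous_edot.
have vW : convex_set W.
  apply/convex_setP => x y t [xb Hx] [yb Hy] /andP[t0 t1].
  have t1' : 0 <= 1 - t by rewrite subr_ge0.
  split=> [|z Kz] /=.
    apply: le_trans (ler_normD _ _) _; rewrite !normrZ !ger0_norm //.
    have := ler_wpM2l t0 xb; have := ler_wpM2l t1' yb; lra.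
  rewrite !edotE; have := ler_wpM2l t0 (Hx z Kz).
  have := ler_wpM2l t1' (Hy z Kz); rewrite /=; lra.
have KW y : K y -> W (y - r *: N y).
  move=> Ky; split=> [|x Kx] /=.
    apply: le_trans (ler_normB _ _) _; rewrite normrZ gtr0_norm // lerD //.
      by apply: HB => //; rewrite (le_lt_trans (ler_norm _)) // ltrDl.
    by rewrite -[leRHS]mulr1 ler_pM2l // -(N_unit Ky) normr_le_enorm.
  have := cond y x Ky Kx; rewrite sqr_enorm !edotE -/c !N_sqr // (edotC (N y) (N x)).
  move: (edot (N x) x) (edot (N x) y) => p q.
  have : 0 <= 1 - edot (N x) (N y).
    by rewrite subr_ge0 (le_trans (edot_le_enorm _ _)) // !N_unit // mulr1.
  move: (edot (N x) (N y)) => s s1 H.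
  have := ler_wpM2r s1 rc; lra.
have [P PP] := projection_exists cW vW (ex_intro _ 0 W0).
(* Going from [P x] to [x] raises [edot (N y)] by at most [r], exactly the margin built into [W]. *)
have sup x y : parallel_body P r x -> K y -> edot (N y) x <= edot (N y) y.
  rewrite /parallel_body /= -sqr_enorm ler_pXn2r ?nnegrE ?enorm_ge0 ?(ltW r0) //.
  move=> xr Ky; have [_ /(_ y Ky) /=] := (PP x).1.
  have := edot_le_enorm (N y) (x - P x); rewrite N_unit // !edotE; lra.
have KV y : K y -> parallel_body P r y.
  move=> Ky; rewrite /parallel_body /=.
  apply: le_trans (sqdist_le PP _ (KW y Ky)) _.
  by rewrite opprB addrC subrK !edotE N_sqr // mulr1 expr2.
have Nn y : K y -> 0 < edot (N y) (N y) by move=> Ky; rewrite N_sqr.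
have clV := parallel_body_closed PP (r := r).
exists (parallel_body P r); split.
- exact: (parallel_body_C11 PP).
- rewrite (parallel_body_interior PP) //=.
  by rewrite (le_lt_trans (sqdist_le PP _ W0)) // subr0 edot0l exprn_gt0.
- move=> y Ky; rewrite frontier_closed //; split; first exact: KV.
  by apply: support_not_interior (Nn y Ky) _ => x Vx; exact: sup.
- by move=> y Ky; apply: support_outwardly_normal (Nn y Ky) _ => // x Vx; exact: sup.
Qed.

End Construction.

(** * Normals of a convex body with C^1 boundary *)

Section Normals.
Context {R : realType} {n : nat}.
Local Set Implicit Arguments.
Local Unset Strict Implicit.
Variable V : set 'rV[R]_n.
Hypothesis V_closed : closed V.
Hypothesis V_convex : convex_set V.
Hypothesis V_int0 : V° 0.

(** The supremum of [edot u] over the open ball is [edot u c + r]; it is approached at [c + t u],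
    with [t < r] chosen to keep half of the supposed excess over [b]. *)
Lemma ball_support c r u b : enorm u = 1 ->
  (forall z, enorm (z - c) < r -> V z) -> (forall z, V z -> edot u z <= b) ->
  0 < r -> edot u c + r <= b.
Proof.
move=> u1 cV ub r0; rewrite leNgt; apply/negP => br.
pose t := Num.max 0 (r - (edot u c + r - b) / 2).
have t0 : 0 <= t by rewrite le_max lexx.
have tr : t < r by rewrite gt_max r0 /= ltrBlDr ltrDl divr_gt0 // subr_gt0.
have tl : r - (edot u c + r - b) / 2 <= t by rewrite le_max lexx orbT.
have := ub (c + t *: u); rewrite !edotE -sqr_enorm u1 expr1n => /(_ (cV _ _)) H.
have : edot u c + t * 1 <= b.
  by apply: H; rewrite addrAC subrr add0r enormZ u1 ger0_norm // mulr1.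
move: br tl; lra.
Qed.

(** If the segment missed the frontier, its traces on the open [V°] and on the closed [V] would
    coincide, hence be clopen and, by connectedness, the whole segment. *)
Lemma segment_crossing a z : V° a -> ~ V° z ->
  exists2 t, 0 <= t <= 1 & frontier V (t *: z + (1 - t) *: a).
Proof.
move=> Va Vz; apply: contrapT => noF.
pose phi t := t *: z + (1 - t) *: a.
have cphi : continuous phi.
  move=> t; apply: cvgD; first by apply: cvgZl; exact: cvg_id.
  by apply: cvgZl; apply: cvgB; [exact: cvg_cst|exact: cvg_id].
have cA : connected (phi @` `[0, 1]).
  apply: connected_continuous_connected; first exact: segment_connected.
  exact: continuous_subspaceT.
have E : phi @` `[0, 1] `&` V° = phi @` `[0, 1] `&` V.
  apply/seteqP; split=> _ [[t t01 <-] Vt]; split; try by exists t.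
    exact: interior_subset.
  apply: contrapT => nVt; apply: noF; exists t; first by move: t01; rewrite /= in_itv.
  by rewrite frontier_closed; [split; [exact: Vt|exact: nVt]|exact: V_closed].
have : phi @` `[0, 1] `&` V° = phi @` `[0, 1].
  apply: cA; last by exists V.
    exists a; split=> //; exists 0; first by rewrite /= in_itv /= lexx ler01.
    by rewrite /phi scale0r add0r subr0 scale1r.
  by exists V° => //; exact: open_interior.
move=> /seteqP[_ /(_ z)]; case=> // ; exists 1.
  by rewrite /= in_itv /= lexx ler01.
by rewrite /phi subrr scale0r addr0 scale1r.
Qed.

(** The homothety centred at [x] with ratio [t] carries a ball of radius [e] around [a] to one of
    radius [t e] around the combination. *)
Lemma interior_convex_comb a x t : V° a -> V x -> 0 < t -> t <= 1 ->
  V° (t *: a + (1 - t) *: x).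
Proof.
move=> /nbhs_enormP[e e0 He] Vx t0 t1; apply/nbhs_enormP.
exists (t * e); first exact: mulr_gt0.
move=> z zt; have tn : t != 0 by rewrite gt_eqF.
have -> : z = t *: (a + t^-1 *: (z - (t *: a + (1 - t) *: x))) + (1 - t) *: x.
  by rewrite scalerDr scalerA divff // scale1r addrAC addrC subrK.
apply: (convex_setP V).1 => //; last by rewrite (ltW t0) t1.
apply: He; rewrite addrAC subrr add0r enormZ ger0_norm ?invr_ge0 ?(ltW t0) //.
by rewrite mulrC ltr_pdivrMr // mulrC.
Qed.

(* [a] is the unit outward normal at [x], and the tangent cone of [V] at [x]
   contains the whole open half-space opposite to [a]. *)
Definition smooth_point (x a : 'rV[R]_n) : Prop :=
  [/\ enorm a = 1, forall z, V z -> edot a z <= edot a x &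
      forall w, edot a w < 0 ->
        exists2 e, 0 < e & forall t, 0 < t < e -> V° (x + t *: w)].

(* The sign [s] makes [s * f] negative inside [V] near [x]. *)
Lemma C1_equation_smooth_point (f : 'rV[R]_n -> R) x s d :
  frontier V x -> 0 < d -> differentiable f x -> grad f x != 0 ->
  s \in [:: 1; -1] ->
  (forall z, enorm (z - x) < d -> frontier V z -> f z = 0) ->
  (forall z, enorm (z - x) < d -> V° z -> s * f z < 0) ->
  smooth_point x (s *: grad_normal f x).
Proof.
move=> Sx d0 df g0 s1 fS fV.
have Vx : V x by move: Sx; rewrite frontier_closed // => -[].
have ns : `|s| = 1 by move: s1; rewrite !inE => /orP[] /eqP ->; rewrite ?normrN normr1.
have fx : f x = 0 by apply: fS => //; rewrite subrr enorm0.
set g := s *: grad f x.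
have gg : 0 < enorm (grad f x) by exact: enorm_gt0.
have ga w : edot (s *: grad_normal f x) w = (enorm (grad f x))^-1 * edot g w.
  by rewrite /grad_normal /g !edotZl mulrCA.
have expand e : 0 < e -> exists2 d', 0 < d' & forall h, enorm h < d' ->
    `|s * f (x + h) - edot g h| <= e * enorm h.
  move=> e0; have [d' d'0 H] := differentiable_edotP df e0; exists d' => // h /H.
  by rewrite fx subr0 /g edotZl -mulrBr normrM ns mul1r.
have supV z : V z -> edot g (z - x) <= 0.
  (* Interior points suffice: shrinking [z] slightly towards the interior point 0 gives an interior
     point, and this [t] is small enough to keep the functional positive. *)
  suff supI y : V° y -> edot g (y - x) <= 0.
    move=> Vz; rewrite leNgt; apply/negP => gz.
    pose t := edot g (z - x) / (2 * (edot g (z - x) + `|edot g z|)).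
    have Dz : 0 < 2 * (edot g (z - x) + `|edot g z|).
      by rewrite mulr_gt0 // ltr_pwDl.
    have t0 : 0 < t by rewrite divr_gt0.
    have tD : t * (2 * (edot g (z - x) + `|edot g z|)) = edot g (z - x).
      by rewrite /t divfK // gt_eqF.
    have t1 : t <= 1.
      by rewrite /t ler_pdivrMr // mul1r; have := normr_ge0 (edot g z); lra.
    have := supI _ (interior_convex_comb V_int0 Vz t0 t1).
    have tg := mulr_gt0 t0 gz.
    have := ler_wpM2l (ltW t0) (ler_norm (edot g z)).
    move: tD gz tg; rewrite scaler0 add0r !edotE; lra.
  move=> Vy; rewrite leNgt; apply/negP => gy.
  set h := y - x in gy; have h1 : 0 < enorm h + 1 by rewrite ltr_wpDl ?enorm_ge0.
  (* With this precision the expansion makes [s * f (x + t h)] positive for small [t], although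
     [x + t h] is interior. *)
  pose e := edot g h / (2 * (enorm h + 1)).
  have e0 : 0 < e by rewrite divr_gt0 // mulr_gt0.
  have eh : e * (2 * (enorm h + 1)) = edot g h.
    by rewrite /e divfK // gt_eqF // mulr_gt0.
  have [d' d'0 H] := expand e e0.
  pose t := Num.min 1 (Num.min d d' / 2 / (enorm h + 1)).
  have dd : 0 < Num.min d d' by rewrite lt_min d0.
  have t0 : 0 < t by rewrite lt_min ltr01 !divr_gt0.
  have t1 : t <= 1 by rewrite ge_min lexx.
  have th : t * enorm h < Num.min d d'.
    have : t * (enorm h + 1) <= Num.min d d' / 2.
      by rewrite -ler_pdivlMr // ge_min lexx orbT.
    have := enorm_ge0 h; move: dd t0; lra.
  move: th; rewrite lt_min => /andP[thd thd'].
  have nth : enorm (t *: h) = t * enorm h by rewrite enormZ gtr0_norm.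
  have := H (t *: h); rewrite nth => /(_ thd'); rewrite ler_norml => /andP[+ _].
  have Vt : V° (x + t *: h).
    have -> : x + t *: h = t *: y + (1 - t) *: x.
      by apply/rowP => i; rewrite !mxE; ring.
    exact: interior_convex_comb.
  have := fV (x + t *: h); rewrite addrAC subrr add0r nth => /(_ thd Vt).
  have := mulr_gt0 t0 e0; have := mulr_gt0 t0 gy.
  have : t * (e * (2 * (enorm h + 1))) = t * edot g h by rewrite eh.
  rewrite edotZr; lra.
(* A small positive multiple of [g] lies in [V] because 0 is interior. Consequently [- x] is a
   strictly inward direction at [x]. *)
have gx : 0 < edot g x.
  have [e e0 He] : exists2 e, 0 < e & forall z, enorm (z - 0) < e -> V z.
    exact/nbhs_enormP.
  have g1 : 0 < enorm g by rewrite /g enormZ ns mul1r.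
  have := supV (e / 2 / enorm g *: g).
  rewrite edotDr edotNr edotZr -sqr_enorm => /(_ _)H.
  have : e / 2 / enorm g * enorm g ^+ 2 - edot g x <= 0.
    apply: H; apply: He; rewrite subr0 enormZ gtr0_norm ?divr_gt0 //.
    by rewrite divfK ?gt_eqF //; lra.
  rewrite expr2 mulrA divfK ?gt_eqF // subr_le0; apply: lt_le_trans.
  by rewrite mulr_gt0 // divr_gt0.
clearbody g; split.
- rewrite enormZ ns mul1r /grad_normal enormZ gtr0_norm ?invr_gt0 //.
  by rewrite mulVf // gt_eqF.
- move=> z Vz; rewrite !ga ler_pM2l ?invr_gt0 //.
  by have := supV z Vz; rewrite !edotE subr_le0.
- move=> w; rewrite ga pmulr_rlt0 ?invr_gt0 // => gw.
  pose c := Num.min (- edot g w) (edot g x).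
  have c0 : 0 < c by rewrite lt_min oppr_gt0 gw.
  have cw : c <= - edot g w by rewrite ge_min lexx.
  have cx : c <= edot g x by rewrite ge_min lexx orbT.
  pose D := enorm w + enorm x + 1.
  have D0 : 0 < D by rewrite ltr_wpDl // addr_ge0 // enorm_ge0.
  have DE : D = enorm w + enorm x + 1 by [].
  clearbody D; clearbody c; pose e := c / (2 * D).
  have e0 : 0 < e by rewrite divr_gt0 // mulr_gt0.
  have eD : e * (2 * D) = c by rewrite /e divfK // gt_eqF // mulr_gt0.
  clearbody e; have [d' d'0 H] := expand e e0.
  have dd : 0 < Num.min d d' by rewrite lt_min d0.
  exists (Num.min 1 (Num.min d d' / D)); first by rewrite lt_min ltr01 divr_gt0.
  move=> t; rewrite lt_min => /andP[t0 /andP[t1]].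
  rewrite (ltr_pdivlMr _ _ D0) lt_min => /andP[tD tD'].
  apply: contrapT => nV.
  (* If [x + t w] were not interior, the segment to it from this interior point would meet the
     frontier at some [x + t h], where [f] vanishes. But [edot g h <= - c], so the first-order
     expansion is negative there. *)
  have Vt : V° (x + t *: - x).
    have -> : x + t *: - x = t *: 0 + (1 - t) *: x.
      by apply/rowP => i; rewrite !mxE; ring.
    exact: (interior_convex_comb V_int0 Vx t0 (ltW t1)).
  have [l /andP[l0 l1]] := segment_crossing Vt nV; clear nV.
  pose h := l *: w + (1 - l) *: - x.
  have -> : l *: (x + t *: w) + (1 - l) *: (x + t *: - x) = x + t *: h.
    by apply/rowP => i; rewrite !mxE; ring.
  have l1' : 0 <= 1 - l by rewrite subr_ge0.
  have hD : enorm h <= D.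
    rewrite /h; apply: le_trans (ler_enormD _ _) _; rewrite !enormZ enormN !ger0_norm //.
    have := ler_wpM2r (enorm_ge0 w) l1.
    have := mulr_ge0 l0 (enorm_ge0 x); rewrite DE; lra.
  have nth : enorm (t *: h) = t * enorm h by rewrite enormZ gtr0_norm.
  have thD : t * enorm h <= t * D by rewrite ler_pM2l.
  have := fS (x + t *: h); rewrite addrAC subrr add0r nth.
  move=> /(_ (le_lt_trans thD tD)) fh /fh {}fh.
  have := H (t *: h); rewrite nth fh mulr0 sub0r normrN.
  move=> /(_ (le_lt_trans thD tD')); rewrite ler_norml => /andP[+ _].
  have gh : edot g h <= - c.
    rewrite /h !edotE; have := ler_wpM2l l0 cw; have := ler_wpM2l l1' cx; lra.
  rewrite edotZr.
  have := ler_wpM2l (ltW t0) gh; have := ler_wpM2l (ltW e0) thD.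
  have : t * (e * (2 * D)) = t * c by rewrite eD.
  have := mulr_gt0 t0 c0; lra.
Qed.

End Normals.

(** * The inner rolling ball *)

Section Rolling.
Context {R : realType} {n : nat}.
Local Set Implicit Arguments.
Local Unset Strict Implicit.
Variable V : set 'rV[R]_n.
Hypothesis V_closed : closed V.
Hypothesis V_convex : convex_set V.
Hypothesis V_int0 : V° 0.

Let S_V x : frontier V x -> V x.
Proof. by rewrite frontier_closed // => -[]. Qed.

Let S_nint x : frontier V x -> ~ V° x.
Proof. by rewrite frontier_closed // => -[]. Qed.

(** A single sign [s] works for all boundary points near [p], so the Lipschitz bound on
    [grad_normal f] passes to the outward normals. *)
Lemma C11_local_normal p : C11_hypersurface (frontier V) -> frontier V p ->
  exists (a : 'rV[R]_n -> 'rV[R]_n) d L, [/\ 0 < d, 0 <= L,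
    forall x, frontier V x -> enorm (x - p) < d -> smooth_point V x (a x) &
    forall x y, frontier V x -> frontier V y -> enorm (x - p) < d ->
      enorm (y - p) < d -> enorm (a x - a y) <= L * enorm (x - y)].
Proof.
move=> C11 Sp; have [U [f [Up [oU fC1 f0 SU] [L HL]]]] := C11 p Sp.
have [e e0 eU] : exists2 e, 0 < e & forall z, enorm (z - p) < e -> U z.
  by apply/nbhs_enormP; exact: open_nbhs_nbhs.
have SUf z : U z -> frontier V z <-> f z = 0.
  move=> Uz; have /seteqP[/(_ z) h1 /(_ z) h2] := SU.
  by split=> h; [have [] := h1 (conj h Uz)|have [] := h2 (conj h Uz)].
have ball_convex z y t : enorm (z - p) < e -> enorm (y - p) < e -> 0 <= t <= 1 ->
    enorm (t *: z + (1 - t) *: y - p) < e.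
  move=> ze ye /andP[t0 t1].
  have -> : t *: z + (1 - t) *: y - p = t *: (z - p) + (1 - t) *: (y - p).
    by apply/rowP => i; rewrite !mxE; ring.
  apply: le_lt_trans (ler_enormD _ _) _; rewrite !enormZ !ger0_norm ?subr_ge0 //.
  have [->|tn] := eqVneq t 0; first lra.
  have tp : 0 < t by rewrite lt_neqAle eq_sym tn.
  have t1' : 0 <= 1 - t by rewrite subr_ge0.
  have : t * enorm (z - p) < t * e by rewrite ltr_pM2l.
  have := ler_wpM2l t1' (ltW ye); lra.
have Vint z y t : V° z -> V° y -> 0 <= t <= 1 -> V° (t *: z + (1 - t) *: y).
  move=> Vz Vy /andP[t0 t1]; have [->|tn] := eqVneq t 0.
    by rewrite scale0r add0r subr0 scale1r.
  apply: interior_convex_comb => //; first exact: interior_subset.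
  by rewrite lt_neqAle eq_sym tn.
have fn0 z : enorm (z - p) < e -> V° z -> f z != 0.
  by move=> /eU Uz Vz; apply/eqP => /(SUf z Uz)/S_nint.
have [z0 z0e Vz0] : exists2 z0, enorm (z0 - p) < e & V° z0.
  have p1 : 0 < enorm p + e by rewrite ltr_wpDl // enorm_ge0.
  exists (e / (enorm p + e) *: 0 + (1 - e / (enorm p + e)) *: p).
    rewrite scaler0 add0r scalerBl scale1r addrAC subrr add0r enormN enormZ.
    rewrite gtr0_norm ?divr_gt0 // mulrAC ltr_pdivrMr // ltr_pM2l //.
    by rewrite ltrDl.
  apply: interior_convex_comb => //; first exact: S_V.
    by rewrite divr_gt0.
  by rewrite ler_pdivrMr // mul1r lerDr enorm_ge0.
pose s : R := if f z0 < 0 then 1 else -1.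
have sP : s \in [:: 1; -1] by rewrite /s; case: ifP; rewrite !inE eqxx ?orbT.
have sz0 : s * f z0 < 0.
  rewrite /s; case: ifPn => [|fz]; first by rewrite mul1r.
  by rewrite mulN1r oppr_lt0 lt_neqAle eq_sym fn0 // leNgt.
have s0 : s != 0 by apply: contraTneq sz0 => ->; rewrite mul0r ltxx.
(* The interior part of the ball is convex and [f] has no zero on it, so the intermediate value
   theorem propagates the sign from [z0]. *)
have fV z : enorm (z - p) < e -> V° z -> s * f z < 0.
  move=> ze Vz; rewrite ltNge; apply/negP => fz.
  pose phi t := t *: z + (1 - t) *: z0.
  have cphi : continuous phi.
    move=> t; apply: cvgD; first by apply: cvgZl; exact: cvg_id.
    by apply: cvgZl; apply: cvgB; [exact: cvg_cst|exact: cvg_id].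
  have phie t : 0 <= t <= 1 -> enorm (phi t - p) < e by exact: ball_convex.
  have cf : {within `[0, 1], continuous (fun t => s * f (phi t))}.
    apply: continuous_in_subspaceT => t; rewrite inE /= in_itv /= => t01.
    have := differentiable_continuous (fC1 _ (eU _ (phie t t01))).1.
    move=> /(continuous_comp (cphi t)) cfphi.
    exact: cvgM (cvg_cst s) cfphi.
  have := IVT ler01 cf (v := 0).
  rewrite /phi !(scale0r, add0r, subr0, scale1r, subrr, addr0).
  rewrite ge_min (ltW sz0) le_max fz orbT => /(_ isT)[c].
  rewrite in_itv /= => c01 /eqP; rewrite mulf_eq0 (negbTE s0) /=; apply/negP.
  by apply: fn0; [exact: phie|exact: Vint].
(* Halving the radius keeps a ball around each [x] inside the chart; [|L|] is taken because the sign
   of [L] is unknown. *)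
exists (fun x => s *: grad_normal f x), (e / 2), `|L|.
have e2 : 0 < e / 2 by rewrite divr_gt0.
have eh x : enorm (x - p) < e / 2 -> enorm (x - p) < e by move=> ?; lra.
split=> // [x Sx xp|x y Sx Sy xp yp].
  have tri z : enorm (z - x) < e / 2 -> enorm (z - p) < e.
    move=> zx; rewrite -(subrK x z) -addrA; apply: le_lt_trans (ler_enormD _ _) _; lra.
  apply: (C1_equation_smooth_point V_closed V_convex V_int0 Sx e2).
  - by have [] := fC1 x (eU _ (eh _ xp)).
  - exact: f0 (eU _ (eh _ xp)).
  - exact: sP.
  - by move=> z /tri/eU Uz /(SUf z Uz).
  - by move=> z /tri; exact: fV.
have -> : s *: grad_normal f x - s *: grad_normal f y =
    s *: (grad_normal f x - grad_normal f y) by rewrite scalerBr.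
rewrite enormZ; have -> : `|s| = 1.
  by move: sP; rewrite !inE => /orP[] /eqP ->; rewrite ?normrN normr1.
rewrite mul1r; apply: le_trans (HL x y _ _) _.
- by split; last exact: eU (eh _ xp).
- by split; last exact: eU (eh _ yp).
by rewrite ler_wpM2r ?enorm_ge0 // ler_norm.
Qed.

(* The curve is [x + t v - s(t) a], where [s(t)] is the least depth at which the
   line through [x + t v] in direction [- a] meets [V]; the tangent cone condition
   gives [s(t) = o(t)]. *)
Lemma tangent_of_orthogonal x a v : frontier V x -> smooth_point V x a ->
  edot a v = 0 -> tangent_vector (frontier V) x v.
Proof.
move=> Sx [a1 asup acone] av.
have aa : edot a a = 1 by rewrite -sqr_enorm a1 expr1n.
pose Q t := [set s : R | [/\ 0 <= s, frontier V (x + t *: v - s *: a) &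
  forall s', V (x + t *: v - s' *: a) -> s <= s']].
have Qex t s : 0 <= s -> V° (x + t *: v - s *: a) -> exists s', Q t s'.
  move=> s0 Vs; have nV : ~ V° (x + t *: v).
    move=> Vxt; apply: (@support_not_interior _ _ V (x + t *: v) a) Vxt.
      by rewrite aa.
    by move=> z /asup; rewrite edotDr edotZr av mulr0 addr0.
  have [l /andP[l0 l1]] := segment_crossing V_closed Vs nV; clear nV.
  have -> : l *: (x + t *: v) + (1 - l) *: (x + t *: v - s *: a) =
      x + t *: v - ((1 - l) * s) *: a by apply/rowP => i; rewrite !mxE; ring.
  set s1 := (1 - l) * s => Fs1.
  have s1s : s1 <= s by have := mulr_ge0 l0 s0; rewrite /s1; lra.
  have s10 : 0 <= s1 by rewrite /s1 mulr_ge0 // subr_ge0.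
  clearbody s1; exists s1; split; [exact: s10|exact: Fs1|].
  (* Were [V] met at a smaller depth, the crossing point would be a combination of that point with
     an interior point, of positive weight on the latter, hence interior. *)
  move=> s' Vs'; rewrite leNgt; apply/negP => s's.
  have ss : 0 < s - s' by lra.
  apply: (S_nint Fs1).
  have -> : x + t *: v - s1 *: a = ((s1 - s') / (s - s')) *: (x + t *: v - s *: a) +
      (1 - (s1 - s') / (s - s')) *: (x + t *: v - s' *: a).
    by apply/rowP => i; rewrite !mxE; field; rewrite gt_eqF.
  apply: (interior_convex_comb V_convex Vs Vs').
    by rewrite divr_gt0 // subr_gt0.
  by rewrite ler_pdivrMr // mul1r lerD2r; exact: s1s.
(* The default 0 is harmless: [Q t] is nonempty for small [t != 0] by [cone] below, and [Q 0 0]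
   holds. *)
pose s t := xget 0 (Q t).
have Qs t eps : V° (x + t *: v - eps *: a) -> 0 <= eps ->
    frontier V (x + t *: v - s t *: a) /\ 0 <= s t <= eps.
  move=> Vt eps0; have [s' Qs'] := Qex t eps eps0 Vt.
  have [s0 Fs smin] : Q t (s t) by exact: (xgetI _ Qs').
  split=> //; rewrite s0 /=; apply: smin; exact: interior_subset.
(* The tangent cone condition is applied to [v - eps a] for [t > 0] and to [- v - eps a] for
   [t < 0]. *)
have cone eps : 0 < eps -> exists2 e, 0 < e & forall t, `|t| < e -> t != 0 ->
    V° (x + t *: v - (`|t| * eps) *: a).
  move=> eps0.
  have W w : edot a w = 0 -> exists2 e, 0 < e & forall t, 0 < t < e ->
      V° (x + t *: w - (t * eps) *: a).
    move=> aw; have [|e e0 He] := acone (w - eps *: a).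
      by rewrite !edotE aw aa add0r mulr1 oppr_lt0.
    exists e => [|t te]; first exact: e0.
    by have := He t te; rewrite scalerBr scalerA addrA.
  have [e e0 He] := W v av.
  have [|e' e'0 He'] := W (- v); first by rewrite edotNr av oppr0.
  exists (Num.min e e') => [|t]; first by rewrite lt_min e0.
  rewrite lt_min => /andP[te te'] tn.
  have [tpos|tneg] := ltP 0 t.
    by move: te; rewrite (gtr0_norm tpos) => te; apply: He; rewrite tpos.
  have tneg' : t < 0 by rewrite lt_neqAle tn.
  move: te'; rewrite (ltr0_norm tneg') => te'.
  have := He' (- t); rewrite oppr_gt0 tneg' te' => /(_ isT).
  by rewrite scalerN scaleNr opprK.
have s00 : s 0 = 0.
  have Q0 : Q 0 0.
    split; rewrite ?lexx // scale0r addr0; first by rewrite scale0r subr0.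
    move=> s' /asup; rewrite !edotE aa; lra.
  have [s0 _ smin] : Q 0 (s 0) by exact: (xgetI _ Q0).
  apply/eqP; rewrite eq_le s0 andbT; apply: smin.
  by rewrite !scale0r addr0 subr0; exact: S_V.
pose g t := x + t *: v - s t *: a.
have g0 : g 0 = x by rewrite /g s00 !scale0r addr0 subr0.
exists g; split=> //.
  have [e e0 He] := cone 1 ltr01.
  exists e => // t /=; rewrite distrC subr0 => te.
  have [->|tn] := eqVneq t 0; first by rewrite g0.
  by have [] := Qs t _ (He t te tn) (mulr_ge0 (normr_ge0 _) ler01).
have gl : h^-1 *: ((g \o shift 0) (h *: 1) - g 0) @[h --> (0 : R)^'] --> v.
  move=> A /nbhs_enormP[e e0 eA].
  have e2 : 0 < e / 2 by rewrite divr_gt0.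
  have [d d0 Hd] := cone _ e2.
  exists d => // h /=; rewrite distrC subr0 => hd hn; apply: eA.
  have [_ /andP[s0 se]] := Qs h _ (Hd h hd hn) (mulr_ge0 (normr_ge0 _) (ltW e2)).
  rewrite addr0 [_%:A]mulr1 g0 /g.
  have -> : h^-1 *: (x + h *: v - s h *: a - x) - v = (- (s h / h)) *: a.
    by apply/rowP => i; rewrite !mxE; field.
  rewrite enormZ a1 mulr1 normrN normrM normfV (ger0_norm s0).
  have hp : 0 < `|h| by rewrite normr_gt0.
  rewrite ltr_pdivrMr //; apply: le_lt_trans se _.
  by rewrite mulrC ltr_pM2r //; lra.
apply: DeriveDef; first by apply/cvg_ex; exists v.
exact: cvg_lim gl.
Qed.

(* Orthogonality to the tangent space only gives [u = a] or [u = - a]; the second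
   case is excluded because [x + t u] leaves [V]. *)
Lemma outward_normal_unique x a u : frontier V x -> smooth_point V x a ->
  enorm u = 1 -> outwardly_normal V x u -> u = a.
Proof.
move=> Sx sa u1 [un /near_right0P[e e0 He]]; have [a1 _ acone] := sa.
have aa : edot a a = 1 by rewrite -sqr_enorm a1 expr1n.
have uu : edot u u = 1 by rewrite -sqr_enorm u1 expr1n.
set k := edot a u.
(* The component of [u] orthogonal to [a] is tangent, hence orthogonal to [u], which gives
   [k^2 = 1]. *)
have av : edot a (u - k *: a) = 0 by rewrite !edotE aa -/k mulr1 subrr.
have := un _ (tangent_of_orthogonal Sx sa av).
rewrite !edotE uu (edotC u a) -/k => kk.
have /eqP : (k - 1) * (k + 1) = 0 by move: kk; lra.
rewrite mulf_eq0 => /orP[] /eqP k1.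
  apply/eqP; rewrite -subr_eq0; apply/eqP/enorm_eq0.
  apply/eqP; rewrite -sqrf_eq0 sqr_enorm !edotE aa uu (edotC u a) -/k; apply/eqP; lra.
have ua : u = - a.
  apply/eqP; rewrite -subr_eq0 opprK; apply/eqP/enorm_eq0.
  apply/eqP; rewrite -sqrf_eq0 sqr_enorm !edotE aa uu (edotC u a) -/k; apply/eqP; lra.
have [|d d0 Hd] := acone u; first by rewrite ua edotNr aa; lra.
have m0 : 0 < Num.min d e by rewrite lt_min d0.
have md : Num.min d e <= d by rewrite ge_min lexx.
have me : Num.min d e <= e by rewrite ge_min lexx orbT.
exfalso; apply: (He (Num.min d e / 2)); [lra|lra|].
by apply: interior_subset; apply: Hd; apply/andP; split; lra.
Qed.

(* The nearest boundary point [q] to the centre [c = x - r a(x)] satisfies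
   [q = c + s a(q)] with [s = |c - q| <= r].  If [s < r], then comparing
   [|a(x) - a(q)|^2] with [L^2 |x - q|^2] is contradictory for [r] small. *)
Lemma local_rolling_ball p :
  compact V -> C11_hypersurface (frontier V) -> frontier V p ->
  exists (a : 'rV[R]_n -> 'rV[R]_n) e, [/\ 0 < e,
    forall x, frontier V x -> enorm (x - p) < e -> smooth_point V x (a x) &
    forall x r, frontier V x -> enorm (x - p) < e -> 0 < r < e ->
      forall z, enorm (z - (x - r *: a x)) < r -> V z].
Proof.
move=> cV C11 Sp.
have [a [d [L [d0 L0 sm lip]]]] := C11_local_normal C11 Sp.
(* [d / 3] keeps every point within [2 r] of [x] at distance less than [d] from [p]; the other bound
   gives [L r <= 1/2]. *)
pose e := Num.min (d / 3) (1 / (2 * (L + 1))).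
have L1 : 0 < 2 * (L + 1) by rewrite mulr_gt0 // ltr_wpDl.
have e0 : 0 < e by rewrite lt_min !divr_gt0.
have ed : e * 3 <= d by rewrite -ler_pdivlMr // ge_min lexx.
have eL : e * (2 * (L + 1)) <= 1 by rewrite -ler_pdivlMr // ge_min lexx orbT.
exists a, e; split=> // [x Sx xe|x r Sx xe /andP[r0 re]]; first by apply: sm => //; lra.
have rL : L ^+ 2 * r ^+ 2 <= 1 / 4.
  rewrite -exprMn; have -> : 1 / 4 = (1 / 2) ^+ 2 :> R by field.
  have Lr : 0 <= L * r by rewrite mulr_ge0 // ltW.
  rewrite ler_pXn2r ?nnegrE //.
  have := ler_wpM2r L0 (ltW re); move: r0 e0 eL; lra.
have sx : smooth_point V x (a x) by apply: sm => //; lra.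
have [ax1 axs axc] := sx.
have axx : edot (a x) (a x) = 1 by rewrite -sqr_enorm ax1 expr1n.
have near_x q : frontier V q -> enorm (q - x) <= 2 * r ->
    [/\ smooth_point V q (a q), edot (a q) (a q) = 1 &
        2 - 2 * edot (a q) (a x) <= L ^+ 2 * edot (q - x) (q - x)].
  move=> Sq qx.
  have qp : enorm (q - p) < d.
    by rewrite -(subrK x q) -addrA; apply: le_lt_trans (ler_enormD _ _) _; lra.
  have sq : smooth_point V q (a q) by exact: sm.
  have [aq1 _ _] := sq.
  have aqq : edot (a q) (a q) = 1 by rewrite -sqr_enorm aq1 expr1n.
  split=> //; rewrite -[edot (q - x) _]sqr_enorm -exprMn.
  have : enorm (a q - a x) ^+ 2 <= (L * enorm (q - x)) ^+ 2.
    rewrite ler_pXn2r ?nnegrE ?mulr_ge0 ?enorm_ge0 //; apply: lip => //; lra.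
  rewrite sqr_enorm !edotE aqq axx (edotC (a x)); lra.
set c := x - r *: a x.
(* A boundary point on the segment from [x] to [c] would have a normal making an
   obtuse angle with [a x], against the Lipschitz bound. *)
have Vc : V° c.
  apply: contrapT => nVc.
  have [|d1 d10 Hd1] := axc (- a x); first by rewrite edotNr axx oppr_lt0.
  have m0 : 0 < Num.min d1 r by rewrite lt_min d10.
  have md : Num.min d1 r <= d1 by rewrite ge_min lexx.
  have mr : Num.min d1 r <= r by rewrite ge_min lexx orbT.
  have Vt : V° (x + (Num.min d1 r / 2) *: - a x) by apply: Hd1; apply/andP; split; lra.
  have [l /andP[l0 l1]] := segment_crossing V_closed Vt nVc; clear nVc.
  pose t := l * r + (1 - l) * (Num.min d1 r / 2).
  have -> : l *: c + (1 - l) *: (x + (Num.min d1 r / 2) *: - a x) = x - t *: a x.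
    by apply/rowP => i; rewrite !mxE /t; field.
  have tr : t <= r.
    have l1' : 0 <= 1 - l by rewrite subr_ge0.
    have : Num.min d1 r / 2 <= r by lra.
    move=> /(ler_wpM2l l1'); rewrite /t; lra.
  have t0 : 0 < t.
    rewrite /t; have [->|ln] := eqVneq l 0; first by rewrite mul0r subr0 mul1r add0r divr_gt0.
    have lp : 0 < l by rewrite lt_neqAle eq_sym ln.
    by rewrite ltr_pwDl ?mulr_gt0 // mulr_ge0 ?subr_ge0 // divr_ge0 // ltW.
  clearbody t => Sq.
  have qx : x - t *: a x - x = - (t *: a x) by rewrite addrAC subrr add0r.
  have [|[_ aqs _] aqq hn] := near_x _ Sq.
    rewrite qx enormN enormZ ax1 gtr0_norm //; lra.
  have := aqs x (S_V Sx); move: hn; rewrite qx.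
  move: (a (x - _)) aqq => q qq.
  rewrite edotDr !edotNr !edotNl !edotZr !edotZl axx opprK => hn H.
  have k0 : edot q (a x) <= 0.
    rewrite -(ler_pM2l t0); move: H; lra.
  have tt : t ^+ 2 <= r ^+ 2 by rewrite ler_pXn2r ?nnegrE // ltW.
  have := ler_wpM2l (sqr_ge0 L) tt; move: hn k0 rL; lra.
have [q [Sq qmin]] : exists q, frontier V q /\
    forall z, frontier V z -> enorm (c - q) <= enorm (c - z).
  have cS : compact (frontier V).
    rewrite frontier_closed // setDE; apply: compact_closedI => //.
    exact/open_closedC/open_interior.
  have cf : {within frontier V, continuous (fun z : 'rV[R]_n => enorm (c - z))}.
    apply: continuous_subspaceT; move=> /= w.
    have cw : (fun z : 'rV[R]_n => c - z) @ nbhs (w : 'rV[R]_n) --> (c - w : 'rV[R]_n).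
      by apply: cvgB; [exact: (cvg_cst c)|exact: cvg_id].
    exact: (cvg_enorm cw).
  have [q /set_mem Sq qmin] := EVT_min_rV (ex_intro _ _ Sx) cS cf.
  by exists q; split=> // z Sz; apply: qmin; exact: mem_set.
have cx : enorm (c - x) = r.
  by rewrite /c addrAC subrr add0r enormN enormZ ax1 mulr1 gtr0_norm.
set s := enorm (c - q) in qmin.
have sr : s <= r by rewrite -cx; exact: qmin.
have s0 : 0 < s.
  apply: enorm_gt0; rewrite subr_eq0; apply/negP => /eqP cq.
  by apply: (S_nint Sq); rewrite -cq.
(* Leaving [V] from the interior point [c] means crossing the frontier, which has no point closer to
   [c] than [s]. *)
have ballV z : enorm (z - c) < s -> V z.
  move=> zs; apply: interior_subset; apply: contrapT => nVz.
  have [l /andP[l0 l1] /qmin] := segment_crossing V_closed Vc nVz; clear nVz.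
  have -> : c - (l *: z + (1 - l) *: c) = - (l *: (z - c)).
    by apply/rowP => i; rewrite !mxE; ring.
  rewrite enormN enormZ ger0_norm //.
  have := ler_wpM2r (enorm_ge0 (z - c)) l1; move: zs; rewrite -/s; lra.
have [|[aq1 aqs _] aqq hn] := near_x q Sq.
  have -> : q - x = (c - x) - (c - q) by apply/rowP => i; rewrite !mxE; ring.
  by apply: le_trans (ler_enormD _ _) _; rewrite enormN cx -/s; lra.
have qs := ball_support aq1 ballV aqs s0.
(* Equality case of Cauchy-Schwarz: [<a q, q - c> >= s] while [|q - c| = s] and [a q] is a unit
   vector. *)
have qc : q = c + s *: a q.
  apply/eqP; rewrite -subr_eq0; apply/eqP/enorm_eq0/eqP; rewrite -sqrf_eq0 sqr_enorm.
  have -> : q - (c + s *: a q) = - ((c - q) + s *: a q).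
    by apply/rowP => i; rewrite !mxE; ring.
  rewrite eq_le edot_ge0 andbT edotNl edotNr opprK.
  have : edot (c - q) (c - q) = s ^+ 2 by rewrite -sqr_enorm.
  have : edot (a q) (c - q) + s <= 0 by rewrite edotDr edotNr; lra.
  move: (c - q) => u us uu; rewrite !edotE uu aqq (edotC u).
  have := ler_wpM2l (ltW s0) us; lra.
have qx : q - x = s *: a q - r *: a x.
  by rewrite {1}qc /c; apply/rowP => i; rewrite !mxE; ring.
suff rs : r <= s by move=> z zr; apply: ballV; exact: lt_le_trans rs.
rewrite leNgt; apply/negP => slr.
(* With [k = <a q, a x>], support at [q] tested on [x] gives [r k <= s], so
   [0 < r - s <= r (1 - k)]. Hence [|q - x|^2 = (r - s)^2 + 2 r s (1 - k) <= 3 r^2 (1 - k)], and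
   [L^2 r^2 <= 1/4] yields [2 (1 - k) <= 3/4 (1 - k)] with [1 - k > 0]. *)
have := aqs x (S_V Sx); rewrite -subr_ge0 -edotNr -edotDr qx.
have k1 : edot (a q) (a x) <= 1.
  by apply: le_trans (edot_le_enorm _ _) _; rewrite aq1 ax1 mulr1.
move: hn; rewrite qx !edotE aqq axx (edotC (a x) (a q)).
move: (edot (a q) (a x)) k1 => k k1 hn srk.
have th0 : 0 <= 1 - k by rewrite subr_ge0.
have rs2 : (r - s) * (r - s) <= r * (r * (1 - k)).
  by apply: ler_pM; lra.
have srt : s * (r * (1 - k)) <= r * (r * (1 - k)).
  by rewrite ler_wpM2r // mulr_ge0 // ltW.
have bound : 2 * (1 - k) <= L ^+ 2 * (3 * (r * (r * (1 - k)))).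
  apply: (@le_trans _ _ (L ^+ 2 * ((r - s) * (r - s) + 2 * (s * (r * (1 - k)))))).
    by move: hn; lra.
  by rewrite ler_wpM2l ?sqr_ge0 //; lra.
have := ler_wpM2r th0 rL.
have : 0 < r * (1 - k) by lra.
rewrite pmulr_rgt0 //; move: bound; lra.
Qed.

End Rolling.

(** * The two implications joined, with the rolling radius made uniform over [K] *)

Theorem theorem1p12 (R : realType) (n : nat) (K : set 'rV[R]_n) (M : R)
    (N : 'rV[R]_n -> 'rV[R]_n)
    (K_compact : compact K) (M_gt0 : 0 < M)
    (N_lipschitz : elipschitz_on K M N)
    (N_unit : forall y, K y -> enorm (N y) = 1) :
  (exists V : set 'rV[R]_n,
     [/\ C11_convex_body V, V° 0, K `<=` frontier V &
         forall y, K y -> outwardly_normal V y (N y)])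
  <->
  ((forall y, K y -> 0 < edot (N y) y) /\
   exists eta : R, 0 < eta <= 1 / 2 /\
     forall x y, K x -> K y ->
       eta / (2 * M) * enorm (N y - N x) ^+ 2 <= edot (N y) (y - x)).
Proof.
split; last first.
  move=> [pos [eta [/andP[eta0 _] cond]]].
  exact: (body_of_condition K_compact M_gt0 N_lipschitz N_unit pos eta0 cond).
move=> [V [[[cV vV _] C11] V0 KS KN]].
have clV : closed V by apply: compact_closed; [exact: norm_hausdorff|exact: cV].
have rolling p (Kp : K p) := local_rolling_ball clV vV V0 cV C11 (KS p Kp).
have normal y a : K y -> smooth_point V y a -> N y = a.
  move=> Ky sa.
  exact: (outward_normal_unique clV vV (KS y Ky) sa (N_unit y Ky) (KN y Ky)).
have support y z : K y -> V z -> edot (N y) z <= edot (N y) y.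
  move=> Ky Vz; have [a [e [e0 sm _]]] := rolling y Ky.
  have sy : smooth_point V y (a y) by apply: sm (KS y Ky) _; rewrite subrr enorm0.
  by rewrite (normal y _ Ky sy); have [_ + _] := sy; apply.
split.
  move=> y Ky; have /nbhs_enormP[e e0 He] := V0.
  have := ball_support (N_unit y Ky) He (fun z => support y z Ky) e0.
  rewrite edot0r add0r; exact: lt_le_trans.
(* The local normal fields all agree with [N] on [K], so the local rolling balls can be stated
   through [N] and compactness applies. *)
have [e e0 He] : exists2 e, 0 < e & forall r, 0 < r < e -> forall x, K x ->
    forall z, enorm (z - (x - r *: N x)) < r -> V z.
  apply: compact_near_right0 => // p Kp; have [a [e [e0 sm ball]]] := rolling p Kp.
  exists e => [|x r Kx xp re z]; first exact: e0.
  rewrite (normal x _ Kx (sm x (KS x Kx) xp)); exact: (ball x r (KS x Kx) xp re z).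
have r0 : 0 < e / 2 by rewrite divr_gt0.
have re : 0 < e / 2 < e by rewrite r0 /=; lra.
set r := e / 2 in r0 re.
(* [r * M] makes [eta / (2 M) <= r / 2], the constant given by the rolling ball; [1 / 2] is the cap
   in the statement. *)
exists (Num.min (1 / 2) (r * M)); split.
  by rewrite ge_min lexx andbT lt_min divr_gt0 //= mulr_gt0.
move=> x y Kx Ky.
have := ball_support (N_unit y Ky) (He r re x Kx) (fun z => support y z Ky) r0.
have min_le : Num.min (1 / 2) (r * M) / (2 * M) <= r / 2.
  rewrite ler_pdivrMr ?mulr_gt0 // (@le_trans _ _ (r * M)) ?ge_min ?lexx ?orbT //.
  by lra.
have := ler_wpM2r (sqr_ge0 (enorm (N y - N x))) min_le.
have sq z : K z -> edot (N z) (N z) = 1 by move=> Kz; rewrite -sqr_enorm N_unit // expr1n.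
have -> : enorm (N y - N x) ^+ 2 = 2 - 2 * edot (N y) (N x).
  rewrite sqr_enorm edotDl !edotDr !edotNl !edotNr !sq // (edotC (N x)); ring.
rewrite !edotDr !edotNr edotZr; lra.
Qed.
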